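(* $\mathbf{ID}_{\infty}$ is an $F$-inverse semigroup.
   Context: A partial cofinite isometry of the set of integers $\mathbb{Z}$ is a partial map $\alpha\colon\mathbb{Z}\rightharpoonup\mathbb{Z}$ such that $\mathbb{Z}\setminus\operatorname{dom}\alpha$ and $\mathbb{Z}\setminus\operatorname{ran}\alpha$ are finite and $|(x)\alpha-(y)\alpha|=|x-y|$ for all $x,y\in\operatorname{dom}\alpha$. $\mathbf{ID}_{\infty}$ is the semigroup (an inverse monoid) of all partial cofinite isometries of $\mathbb{Z}$ under composition of partial maps (maps written on the right). The natural partial order on an inverse semigroup $S$: $s\leqslant t$ iff $s=te$ for some idempotent $e\in S$. The least group congruence $\mathfrak{C}_{\mathsf{mg}}$ on an inverse semigroup $S$: $s\,\mathfrak{C}_{\mathsf{mg}}\,t$ iff there is an idempotent $e\in S$ with $es=et$. An inverse semigroup $S$ is called $F$-inverse if for every $s\in S$ the $\mathfrak{C}_{\mathsf{mg}}$-class of $s$ has a greatest element with respect to the natural partial order on $S$. *)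

(* Defs.v *)
From HB Require Import structures.
From mathcomp Require Import all_boot all_order all_algebra.
From mathcomp Require Import all_classical.

Set Implicit Arguments.
Unset Strict Implicit.
Unset Printing Implicit Defensive.

Import Order.TTheory GRing.Theory Num.Theory.
Local Open Scope classical_set_scope.

Section InverseSemigroups.
Local Open Scope group_scope.
Variable S : semigroupType.
Implicit Types s t e m : S.

Definition idempotent e : Prop := e * e = e.

Definition inverse_semigroup : Prop :=
  forall s, exists! t, s * t * s = s /\ t * s * t = t.

Definition natural_le s t : Prop := exists e, idempotent e /\ s = t * e.

Definition least_group_congruence s t : Prop :=
  exists e, idempotent e /\ e * s = e * t.

Definition F_inverse : Prop :=
  inverse_semigroup /\
  forall s, exists m, least_group_congruence s m /\
    forall t, least_group_congruence s t -> natural_le t m.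

End InverseSemigroups.

(* Partial maps T -> T are functions f : T -> option T, with f x = None when  *)
(* f is undefined at x.                                                       *)
Definition pdom {T : Type} (f : T -> option T) : set T :=
  [set x | exists y, f x = Some y].

Definition pran {T : Type} (f : T -> option T) : set T :=
  [set y | exists x, f x = Some y].

Definition partial_isometry (f : int -> option int) : Prop :=
  forall x y x' y' : int, f x = Some x' -> f y = Some y' ->
    `|x' - y'|%R = `|x - y|%R.

Definition partial_cofinite_isometry (f : int -> option int) : Prop :=
  [/\ cofinite_set (pdom f), cofinite_set (pran f) & partial_isometry f].

Record ID_infty : Type := IDInfty {
  pmap_of :> int -> option int;
  pmap_ofP : partial_cofinite_isometry pmap_of
}.

Lemma ID_infty_inj (a b : ID_infty) : a =1 b -> a = b.
Proof.
case: a b => [f fP] [g gP] /= /funext fg.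
by move: fP; rewrite fg => fP; rewrite (Prop_irrelevance fP gP).
Qed.

HB.instance Definition _ := gen_eqMixin ID_infty.
HB.instance Definition _ := gen_choiceMixin ID_infty.

(* As pcomp g f x = obind g (f x), the map f is applied first in pcomp g f.   *)
Lemma pcomp_cofinite_isometry (f g : int -> option int) :
  partial_cofinite_isometry f -> partial_cofinite_isometry g ->
  partial_cofinite_isometry (pcomp g f).
Proof.
move=> [fdom fran fiso] [gdom gran giso]; split.
- have fin : finite_set (f @^-1` (Some @` ~` pdom g)).
    apply: finite_preimage (finite_image _ gdom) => x y _.
    rewrite inE => -[z _ fy] fxy.
    have := fiso x y z z; rewrite fxy -fy subrr normr0 => /(_ erefl erefl).
    by move=> /esym/eqP; rewrite normr_eq0 subr_eq0 => /eqP.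
  apply: (@sub_finite_set _ _
    (~` pdom f `|` f @^-1` (Some @` (~` pdom g)))); last by rewrite finite_setU.
  move=> x ndom; have [[y fx]|] := pselect (pdom f x); last by left.
  right; exists y; last by rewrite fx.
  by move=> [z gy]; apply: ndom; exists z; rewrite /pcomp fx.
- apply: (@sub_finite_set _ _
    (~` pran g `|` (odflt 0%R \o g) @` (~` pran f))); last first.
    by rewrite finite_setU; split; last exact: finite_image.
  move=> z nran; have [[y gy]|] := pselect (pran g z); last by left.
  right; exists y; last by rewrite /= gy.
  by move=> [x fx]; apply: nran; exists x; rewrite /pcomp fx.
move=> x y x' y'; rewrite /pcomp.
case fx: (f x) => [u|] //= gu; case fy: (f y) => [v|] //= gv.
by rewrite (giso _ _ _ _ gu gv) (fiso _ _ _ _ fx fy).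
Qed.

(* Maps are written on the right: (x)(a b) = ((x)a)b.                         *)
Definition ID_mul (a b : ID_infty) : ID_infty :=
  IDInfty (pcomp_cofinite_isometry (pmap_ofP a) (pmap_ofP b)).

Lemma ID_mulA : associative ID_mul.
Proof.
by move=> a b c; apply: ID_infty_inj => x /=; rewrite /pcomp; case: (pmap_of a x).
Qed.

HB.instance Definition _ := isSemigroup.Build ID_infty ID_mulA.

(* Main.v *)
Require Import Defs.
From mathcomp Require Import all_boot all_order all_algebra.
From mathcomp Require Import all_classical.
From mathcomp Require Import zify.

(** An isometry between subsets of the line is determined by its values at two
    distinct points ([partial_isometry_rigid]), and any distance-preserving
    assignment of values to two points of $\mathbb{Z}$ extends to a translation
    or a reflection of $\mathbb{Z}$.  Hence every partial cofinite isometry is a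
    restriction of a total one ([total_extension]).

    Partial isometries are injective, so they have relational inverses, and an
    inverse in the semigroup has to be the relational one
    ([pcomp_inverseP]).  The idempotents are the partial identities.
    Therefore $es = et$ means that $s$ and $t$ agree on the domain of $e$, up to
    both being undefined.  As cofinite subsets of $\mathbb{Z}$ meet
    in more than two points, two congruent elements agree at two distinct
    points, so they are restrictions of the same total isometry; that isometry
    lies in their class and is its greatest element. *)

Set Implicit Arguments.
Unset Strict Implicit.
Unset Printing Implicit Defensive.

Local Open Scope classical_set_scope.

(** * Partial injections *)

Definition pinjective {T : Type} (f : T -> option T) : Prop :=
  forall x y z, f x = Some z -> f y = Some z -> x = y.

Definition pinv {T : Type} (f : T -> option T) (y : T) : option T :=
  if pselect (pran f y) is left h then Some (sval (cid h)) else None.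

Lemma pinvP {T : Type} (f : T -> option T) x y :
  pinjective f -> pinv f y = Some x <-> f x = Some y.
Proof.
move=> finj; rewrite /pinv; case: pselect => [h|nran]; split => //.
- by case=> <-; case: (cid h).
- by case: (cid h) => z /= fz fx; rewrite (finj _ _ _ fz fx).
- by move=> fx; case: nran; exists x.
Qed.

(** If $fgf = f$ and $f x = y$, then $g y$ is a point with image $y$, so it is
    $x$; the other direction exchanges $f$ and $g$. *)
Lemma pcomp_inverseP {T : Type} (f g : T -> option T) :
  pinjective f -> pinjective g ->
  pcomp f (pcomp g f) =1 f -> pcomp g (pcomp f g) =1 g ->
  forall x y, g y = Some x <-> f x = Some y.
Proof.
have half (h k : T -> option T) : pinjective h ->
    pcomp h (pcomp k h) =1 h -> forall x y, h x = Some y -> k y = Some x.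
  move=> hinj hkh x y hx; have := hkh x; rewrite /pcomp hx /=.
  by case: (k y) => //= z hz; rewrite (hinj _ _ _ hz hx).
by move=> finj ginj fgf gfg x y; split; apply: half.
Qed.

(** * Isometries of the line *)

Lemma partial_isometry_inj f : partial_isometry f -> pinjective f.
Proof. by move=> fiso x y z fx fy; have := fiso _ _ _ _ fx fy; lia. Qed.

(** A point of the line is determined by its distances to two distinct
    points. *)
Lemma partial_isometry_rigid f g p q p' q' x u v :
  partial_isometry f -> partial_isometry g -> p <> q ->
  f p = Some p' -> g p = Some p' -> f q = Some q' -> g q = Some q' ->
  f x = Some u -> g x = Some v -> u = v.
Proof.
move=> fiso giso pq fp gp fq gq fx gx.
have := fiso _ _ _ _ fp fq; have := fiso _ _ _ _ fx fp.
have := fiso _ _ _ _ fx fq; have := giso _ _ _ _ gx gp.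
have := giso _ _ _ _ gx gq; lia.
Qed.

Lemma cofinite_two_points (A : set int) :
  cofinite_set A -> exists p q, [/\ p <> q, A p & A q].
Proof.
have infinite_int : ~ finite_set [set: int].
  move=> fin; apply: infinite_nat.
  have -> : [set: nat] = Posz @^-1` [set: int] by [].
  by apply: finite_preimage fin => m n _ _ [].
have point (B : set int) : cofinite_set B -> exists p, B p.
  move=> Bcof; apply: contrapT => nB; apply: infinite_int.
  by apply: sub_finite_set Bcof => x _ Bx; apply: nB; exists x.
move=> Acof; have [p Ap] := point _ Acof.
have [|q [Aq qp]] := point (A `\ p); last by exists p, q; split=> // /esym.
by rewrite setDE setCI setCK finite_setU.
Qed.

(** * Elements of the semigroup *)

Lemma ID_pinj (s : ID_infty) : pinjective s.
Proof. by case: (pmap_ofP s) => _ _ /partial_isometry_inj. Qed.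

Lemma ID_iso (s : ID_infty) : partial_isometry s.
Proof. by case: (pmap_ofP s). Qed.

Lemma pinv_cofinite_isometry f :
  partial_cofinite_isometry f -> partial_cofinite_isometry (pinv f).
Proof.
move=> [fdom fran fiso]; have finj := partial_isometry_inj fiso.
split.
- apply: sub_finite_set fran => y ndom [x fx]; apply: ndom.
  by exists x; apply/pinvP.
- apply: sub_finite_set fdom => x nran [y fx]; apply: nran.
  by exists y; apply/pinvP.
move=> y z x w /(pinvP _ _ finj) fx /(pinvP _ _ finj) fw.
by rewrite (fiso _ _ _ _ fx fw).
Qed.

Definition ID_inv (s : ID_infty) : ID_infty :=
  IDInfty (pinv_cofinite_isometry (pmap_ofP s)).

Definition pid {T : Type} (A : set T) (x : T) : option T :=
  if `[< A x >] then Some x else None.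

Lemma pid_cofinite_isometry (A : set int) :
  cofinite_set A -> partial_cofinite_isometry (pid A).
Proof.
move=> Acof; split; last 1 first.
- by rewrite /pid => x y x' y'; case: asboolP => // _ [<-];
    case: asboolP => // _ [<-].
- by apply: sub_finite_set Acof => x nx Ax; apply: nx;
    exists x; rewrite /pid asboolT.
- by apply: sub_finite_set Acof => x nx Ax; apply: nx;
    exists x; rewrite /pid asboolT.
Qed.

Definition ID_pid (A : set int) (Acof : cofinite_set A) : ID_infty :=
  IDInfty (pid_cofinite_isometry Acof).

Lemma ID_pid_idempotent (A : set int) (Acof : cofinite_set A) :
  Defs.idempotent (ID_pid Acof).
Proof.
apply: ID_infty_inj => x; rewrite /= /pcomp /pid.
by case: (asboolP (A x)) => //= Ax; rewrite asboolT.
Qed.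

(** From $e x = y$ idempotency gives $e y = y$, and injectivity $x = y$. *)
Lemma idempotent_fixes (e : ID_infty) x y :
  Defs.idempotent e -> e x = Some y -> y = x.
Proof.
move=> ee ex; have := congr1 (fun s : ID_infty => s x) ee.
rewrite /= /pcomp ex /= => ey; exact: ID_pinj ey ex.
Qed.

Lemma ID_inverse_semigroup : inverse_semigroup ID_infty.
Proof.
move=> s; exists (ID_inv s); split.
  have sP x y := pinvP x y (@ID_pinj s).
  split; apply: ID_infty_inj => x; rewrite /= /pcomp /=.
    by case sx: (pmap_of s x) => [y|] //=; move/sP: (sx) => -> /=.
  by case ix: (pinv s x) => [y|] //=; move/sP: (ix) => -> /=.
move=> t [sts tst]; apply: ID_infty_inj => y.
have tP : forall x z, t z = Some x <-> s x = Some z.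
  apply: pcomp_inverseP => [||x|x]; try exact: ID_pinj.
    rewrite -[RHS](congr1 (fun r : ID_infty => r x) sts) /= /pcomp /=.
    by case: (pmap_of s x).
  rewrite -[RHS](congr1 (fun r : ID_infty => r x) tst) /= /pcomp /=.
  by case: (pmap_of t x).
have sP x := pinvP x y (@ID_pinj s).
case ty: (pmap_of t y) => [x|]; first by apply/sP/tP.
by case iy: (pinv s y) => [x|] //; move/sP/tP: iy; rewrite ty.
Qed.

(** * The greatest element of a class *)

Lemma total_isometry_cofinite (h k : int -> int) :
  cancel k h -> {mono h : x y / `|x - y|%R} ->
  partial_cofinite_isometry (Some \o h).
Proof.
move=> kK hiso; split; last by move=> x y _ _ [<-] [<-].
- by apply: sub_finite_set (finite_set0 int) => x; apply; exists (h x).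
- by apply: sub_finite_set (finite_set0 int) => y; apply; exists (k y);
    rewrite /= kK.
Qed.

Lemma two_point_extension (p q p' q' : int) :
  `|p' - q'|%R = `|p - q|%R ->
  exists m : ID_infty,
    [/\ forall x, pdom m x, m p = Some p' & m q = Some q'].
Proof.
move=> dist.
(* The translation is taken when it sends q to q'; otherwise the two
   displacements are opposite and the reflection does. *)
have [shift|flip] := eqVneq (p' - q')%R (p - q)%R.
  have cof : partial_cofinite_isometry (Some \o fun x => (x - p + p')%R).
    by apply: (@total_isometry_cofinite _ (fun y => (y - p' + p)%R)) => [y|x y];
      lia.
  by exists (IDInfty cof); split=> [x||] /=;
    [exists (x - p + p')%R | congr Some; lia | congr Some; lia].
have cof : partial_cofinite_isometry (Some \o fun x => (p - x + p')%R).
  by apply: (@total_isometry_cofinite _ (fun y => (p' - y + p)%R)) => [y|x y];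
    lia.
by exists (IDInfty cof); split=> [x||] /=;
  [exists (p - x + p')%R | congr Some; lia | congr Some; lia].
Qed.

Lemma total_extension (s : ID_infty) :
  exists m : ID_infty, (forall x, pdom m x) /\
    forall x y, s x = Some y -> m x = Some y.
Proof.
have [sdom _ siso] := pmap_ofP s.
have [p [q [pq [p' sp] [q' sq]]]] := cofinite_two_points sdom.
have [m [mtot mp mq]] := two_point_extension (siso _ _ _ _ sp sq).
exists m; split=> // x y sx; have [z mx] := mtot x.
by rewrite mx (partial_isometry_rigid siso (@ID_iso m) pq sp mp sq mq sx mx).
Qed.

Lemma restriction_congruent (s m : ID_infty) :
  (forall x y, s x = Some y -> m x = Some y) -> least_group_congruence s m.
Proof.
move=> sm; have [sdom _ _] := pmap_ofP s.
exists (ID_pid sdom); split; first exact: ID_pid_idempotent.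
apply: ID_infty_inj => x; rewrite /= /pcomp /pid.
by case: asboolP => //= -[y sx]; rewrite sx (sm _ _ sx).
Qed.

(** The idempotent cuts down on the side of values: it is the identity on the
    range of $t$.  Injectivity of $m$ ensures that it removes every point
    outside the domain of $t$. *)
Lemma restriction_le (t m : ID_infty) :
  (forall x y, t x = Some y -> m x = Some y) -> natural_le t m.
Proof.
move=> tm; have [_ tran _] := pmap_ofP t.
exists (ID_pid tran); split; first exact: ID_pid_idempotent.
apply: ID_infty_inj => x; rewrite /= /pcomp /pid.
case tx: (pmap_of t x) => [y|].
  by rewrite (tm _ _ tx) /= asboolT //; exists x.
case mx: (pmap_of m x) => [y|] //=; case: asboolP => // -[z tz].
by have xz := ID_pinj mx (tm _ _ tz); move: tz; rewrite -xz tx.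
Qed.

Lemma congruent_agree (s t : ID_infty) :
  least_group_congruence s t ->
  exists p q p' q', [/\ p <> q, s p = Some p', t p = Some p',
    s q = Some q' & t q = Some q'].
Proof.
move=> [e [ee est]].
(* The domain of the product of e and s consists of the common points. *)
have agree x : pdom (ID_mul e s) x ->
    exists y, s x = Some y /\ t x = Some y.
  move=> [y]; have := congr1 (fun r : ID_infty => r x) est.
  rewrite /= /pcomp; case ex: (pmap_of e x) => [z|] //=.
  by rewrite (idempotent_fixes ee ex) => <- sx; exists y.
have [esdom _ _] := pmap_ofP (ID_mul e s).
have [p [q [pq /agree[p' [sp tp]] /agree[q' [sq tq]]]]] :=
  cofinite_two_points esdom.
by exists p, q, p', q'.
Qed.

Theorem mainTheorem2 : F_inverse ID_infty.
Proof.
split; first exact: ID_inverse_semigroup.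
move=> s; have [m [mtot sm]] := total_extension s.
exists m; split; first exact: restriction_congruent.
move=> t /congruent_agree[p [q [p' [q' [pq sp tp sq tq]]]]].
apply: restriction_le => x y tx; have [z mx] := mtot x.
by rewrite mx (partial_isometry_rigid (@ID_iso t) (@ID_iso m) pq tp
  (sm _ _ sp) tq (sm _ _ sq) tx mx).
Qed.
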